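(* Let $X$ be a normed space, let $s>0$, let $F\subset X$ be a nonempty closed bounded convex set with $F\ne\{0\}$, and let $f:X\to(-\infty,\infty]$ be an extended-real-valued function. Let $T_F^f(x):=\inf\{\rho_F(y-x)+f(y)\mid y\in X\}$ for $x\in X$, where $\rho_F$ is the Minkowski gauge of $F$, and let $\bar x\in S_0:=\{x\in\mathrm{dom}\,T_F^f\mid T_F^f(x)=f(x)\}$. Suppose that $f$ satisfies a center-Lipschitz condition on $D:=\mathrm{dom}\,f$ at $\bar x$ with constant $\ell$, where $0\le\ell<\|F\|^{-1}$. Then $$\partial_sT_F^f(\bar x)=\partial_sf(\bar x)\cap\Big\{x^*\in X^*\;\Big|\;\sup_{u\in F}\langle-x^*,u\rangle\le1\Big\}.$$
   Context: $X$ is a (real) normed space, $X^*$ its topological dual, and $\langle\cdot,\cdot\rangle$ the pairing between them. The Minkowski gauge of $F$ is $\rho_F(x):=\inf\{t\ge0\mid x\in tF\}$ (with $\inf\emptyset=\infty$); $F$ is not assumed to contain $0$. $\|F\|:=\sup\{\|u\|\mid u\in F\}$. For $g:X\to[-\infty,\infty]$, $\mathrm{dom}\,g:=\{x\in X\mid |g(x)|<\infty\}$. For $\bar x\in\mathrm{dom}\,g$ and $s>0$, the $s$-Hölder subdifferential is $$\partial_s g(\bar x):=\Big\{x^*\in X^*\;\Big|\;\liminf_{x\to\bar x}\frac{g(x)-g(\bar x)-\langle x^*,x-\bar x\rangle}{\|x-\bar x\|^{1+s}}>-\infty\Big\},$$ where the liminf is over $x\neq\bar x$. A function $g$ satisfies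 a center-Lipschitz condition on a set $D\subset X$ at $\bar x\in D$ with constant $\ell\ge0$ if $|g(x)-g(\bar x)|\le\ell\|x-\bar x\|$ for all $x\in D$. *)

(* Defs.v *)
From HB Require Import structures.
From mathcomp Require Import all_boot all_order all_algebra.
From mathcomp Require Import all_classical all_reals all_analysis.

Set Implicit Arguments.
Unset Strict Implicit.
Unset Printing Implicit Defensive.

Import Order.TTheory GRing.Theory Num.Theory.
Import numFieldNormedType.Exports.

Local Open Scope classical_set_scope.
Local Open Scope ring_scope.
Local Open Scope ereal_scope.

Definition edom (R : realType) (X : normedModType R) (g : X -> \bar R) : set X :=
  [set x | `|g x| < +oo].

(* No [0 \in F] is assumed; the infimum of the empty set is +oo. *)
Definition minkowski_gauge (R : realType) (X : normedModType R) (F : set X)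
    (x : X) : \bar R :=
  ereal_inf [set t%:E | t in [set t : R | (0 <= t)%R /\
                                          [set (t *: u)%R | u in F] x]].

(* The sum is never +oo + -oo when [f] does not take the value -oo, since
   the gauge is nonnegative. *)
Definition inf_gauge_conv (R : realType) (X : normedModType R) (F : set X)
    (f : X -> \bar R) (x : X) : \bar R :=
  ereal_inf [set minkowski_gauge F (y - x)%R + f y | y in [set: X]].

Definition coincidence_set (R : realType) (X : normedModType R) (F : set X)
    (f : X -> \bar R) : set X :=
  [set x | edom (inf_gauge_conv F f) x /\ inf_gauge_conv F f x = f x].

(* Real-valued supremum, meaningful for [F] nonempty and bounded. *)
Definition set_norm (R : realType) (X : normedModType R) (F : set X) : R :=
  sup [set `|u|%R | u in F].

(* Intended for [D xbar] and [0 <= l]. *)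
Definition center_lipschitz (R : realType) (X : normedModType R)
    (g : X -> \bar R) (D : set X) (xbar : X) (l : R) : Prop :=
  forall x, D x -> `|g x - g xbar| <= (l * `|x - xbar|)%:E.

Definition top_dual (R : realType) (X : normedModType R) :
    set {linear X -> R^o} :=
  [set xs : {linear X -> R^o} | continuous xs].
Arguments top_dual {R} X.

(* Intended for [xbar] in [edom g] and [0 < s]; the filter [xbar^'] of
   punctured neighbourhoods makes the lower limit range over [x != xbar]. *)
Definition holder_subdiff (R : realType) (X : normedModType R) (s : R)
    (g : X -> \bar R) (xbar : X) : set {linear X -> R^o} :=
  [set xs : {linear X -> R^o} | top_dual X xs /\
    -oo < limf_einf
      (fun x : X => (g x - g xbar - (xs (x - xbar)%R)%:E) /
                    (`|x - xbar| `^ (1 + s))%:E)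
      xbar^'].

(* Main.v *)
(* Write [T] for the infimal convolution and [a := f xbar = T xbar].  Since
   [T <= f] with equality at [xbar], subgradients of [T] are subgradients of
   [f]; since [T (xbar - t *: u) <= t + a] for [u] in [F] and [t >= 0], they
   also satisfy [- xs u <= 1].  Conversely, [T x] is the infimum of
   [t + f (x + t *: u)] over [t >= 0] and [u] in [F].  The points
   [x + t *: u] at which [t + f (x + t *: u) >= a + xs (x - xbar)] satisfy the
   subgradient inequality trivially.  At the others, the center-Lipschitz
   condition with [l * set_norm F < 1] bounds [t], hence
   [`|x + t *: u - xbar|], by a multiple of [`|x - xbar|], so the inequality
   for [f] at [x + t *: u], combined with [- xs u <= 1], gives the one for
   [T] at [x]. *)

Require Import Defs.
From HB Require Import structures.
From mathcomp Require Import all_boot all_order all_algebra.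
From mathcomp Require Import all_classical all_reals all_analysis.
From mathcomp Require Import lra.

Set Implicit Arguments.
Unset Strict Implicit.
Unset Printing Implicit Defensive.

Import Order.TTheory GRing.Theory Num.Theory.
Import numFieldNormedType.Exports.

Local Open Scope classical_set_scope.
Local Open Scope ring_scope.

(** The lower limit is minus an infimum, over the members [V] of [G], of suprema of [- h], so it
    exceeds [-oo] exactly when one of these suprema is not [+oo]. *)
Lemma limf_einf_gtNyP (T : choiceType) (X : filteredType T) (R : realType)
    (h : X -> \bar R) (G : set_system X) : Filter G ->
  (-oo < limf_einf h G)%E <-> exists M : R, \forall x \near G, (M%:E <= h x)%E.
Proof.
move=> FG; rewrite /limf_einf /limf_esup lteNr /=; split.
- move=> /ereal_inf_lt[_ [V GV <-] supV].
  have [M supM] : exists M : R, (ereal_sup [set (- h x)%E | x in V] <= M%:E)%E.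
    (* The supremum may be [-oo], as when [V] is empty; any real bounds it then, and [0] is
       taken. *)
    case: (ereal_sup _) supV => [r _|//|_]; first by exists r.
    by exists 0; rewrite leNye.
  exists (- M); apply: filterS GV => x Vx.
  rewrite EFinN leeNl; apply: le_trans supM.
  by apply: ereal_sup_ubound; exists x.
- move=> [M GM]; apply: (@le_lt_trans _ _ (- M)%:E); last exact: ltry.
  apply: ge_ereal_inf; eexists; first by exists [set x | (M%:E <= h x)%E].
  by apply: ge_ereal_sup => _ [x /= Mx <-]; rewrite EFinN leeN2.
Qed.

Lemma lee_pdivlMr_fin (R : realType) (M c : R) (x : \bar R) : 0 < c ->
  (M%:E <= x / c%:E)%E = ((M * c)%:E <= x)%E.
Proof.
move=> c0; rewrite inver gt_eqF//.
case: x => [r| |].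
- by rewrite -EFinM !lee_fin ler_pdivlMr.
- by rewrite gt0_mulye ?lte_fin ?invr_gt0// !leey.
- by rewrite gt0_mulNye ?lte_fin ?invr_gt0.
Qed.

(** Clearing the denominator lets the inequality hold trivially at [xbar], so full neighbourhoods
    replace punctured ones; a lower bound [M] of the quotient gives [K = |M|]. *)
Lemma holder_subdiffP (R : realType) (X : normedModType R) (s : R)
    (g : X -> \bar R) (xbar : X) (a : R) (xs : {linear X -> R^o}) :
  0 < s -> g xbar = a%:E ->
  holder_subdiff s g xbar xs <->
  top_dual X xs /\ exists2 K : R, 0 <= K & \forall x \near xbar,
    ((a + xs (x - xbar) - K * `|x - xbar| `^ (1 + s))%:E <= g x)%E.
Proof.
move=> s0 ga.
have quot (M : R) (x : X) : x != xbar ->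
    (M%:E <= (g x - g xbar - (xs (x - xbar))%:E) /
             (`|x - xbar| `^ (1 + s))%:E)%E =
    ((a + xs (x - xbar) + M * `|x - xbar| `^ (1 + s))%:E <= g x)%E.
  move=> xx; rewrite lee_pdivlMr_fin ?powR_gt0 ?normr_gt0 ?subr_eq0// ga.
  case: (g x) => [r| |//]; last by rewrite !leey.
  by rewrite -!EFinB !lee_fin; apply/idP/idP; lra.
split=> -[cxs].
- move=> /limf_einf_gtNyP[M Mg]; split=> //; exists `|M| => //.
  near=> x; have [->|xx] := eqVneq x xbar.
    by rewrite subrr raddf0 normr0 powR0 ?gt_eqF ?addr_gt0// mulr0 subr0 addr0 ga.
  have : (M%:E <= (g x - g xbar - (xs (x - xbar))%:E) /
             (`|x - xbar| `^ (1 + s))%:E)%E.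
    by move: xx; near: x.
  rewrite quot//; apply: le_trans.
  rewrite lee_fin lerD2l -mulNr ler_wpM2r ?powR_ge0//.
  by rewrite lerNl ler_normr lexx orbT.
- move=> [K K0 Kg]; split=> //; apply/limf_einf_gtNyP; exists (- K).
  by apply: filterS Kg => x Kx xx; rewrite quot// mulNr.
Unshelve. all: by end_near. Qed.

Section inf_gauge.
Context {R : realType} {X : normedModType R}.
Implicit Types (F : set X) (f : X -> \bar R).

Lemma minkowski_gauge_ge0 F x : (0 <= minkowski_gauge F x)%E.
Proof. by apply/ereal_infP => _ [t [t0 _] <-]; rewrite lee_fin. Qed.

Lemma minkowski_gauge_le F (t : R) u : 0 <= t -> F u ->
  (minkowski_gauge F (t *: u) <= t%:E)%E.
Proof.
by move=> t0 Fu; apply: ereal_inf_lbound; exists t => //; split=> //; exists u.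
Qed.

Lemma inf_gauge_conv_le F f x (t : R) u : 0 <= t -> F u ->
  (inf_gauge_conv F f x <= t%:E + f (x + t *: u)%R)%E.
Proof.
move=> t0 Fu; apply: ge_ereal_inf; eexists; first by exists (x + t *: u).
by apply: leeD => //; rewrite addrAC subrr add0r minkowski_gauge_le.
Qed.

Lemma inf_gauge_conv_le_self F f x : F !=set0 ->
  (inf_gauge_conv F f x <= f x)%E.
Proof.
move=> [u Fu]; have := @inf_gauge_conv_le F f x 0 u (lexx 0) Fu.
by rewrite scale0r addr0 add0e.
Qed.

(** For finite [f y], subtracting it reduces the bound to one on the gauge of [y - x], tested on
    each representation [y - x = t *: u]; without one the gauge is [+oo]. *)
Lemma inf_gauge_conv_ge F f x (a : R) : (forall y, -oo < f y)%E ->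
  (forall (t : R) u, 0 <= t -> F u -> (a%:E <= t%:E + f (x + t *: u)%R)%E) ->
  (a%:E <= inf_gauge_conv F f x)%E.
Proof.
move=> fNy le_a; apply/ereal_infP => _ [y _ <-].
case fy: (f y) (fNy y) => [r| |] // _; last first.
  rewrite addey ?leey//; move: (minkowski_gauge_ge0 F (y - x)).
  by case: (minkowski_gauge _ _).
rewrite -leeBlDr//; apply/ereal_infP => _ [t [t0 [u Fu tu]] <-].
by rewrite leeBlDr// -fy (_ : y = x + t *: u) ?le_a// tu addrC subrK.
Qed.

End inf_gauge.

Lemma continuous_linear_lipschitz (R : realType) (X : normedModType R)
    (xs : {linear X -> R^o}) : continuous xs ->
  exists2 k : R, 0 <= k & forall x, `|xs x| <= k * `|x|.
Proof.
move=> /linear_bounded_continuous/linear_boundedP/pinfty_ex_gt0[k k0 xsk].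
by exists k => //; exact: ltW.
Qed.

Lemma set_norm_ge (R : realType) (X : normedModType R) (F : set X) u :
  bounded_set F -> F u -> `|u| <= set_norm F.
Proof.
move=> [M [_ bM]] Fu; apply: ub_le_sup; last by exists u.
exists (M + 1) => _ [v Fv <-]; apply: (bM (M + 1)) => //.
by rewrite ltrDl.
Qed.

Lemma set_norm_gt0 (R : realType) (X : normedModType R) (F : set X) :
  bounded_set F -> F !=set0 -> F <> [set 0] -> 0 < set_norm F.
Proof.
move=> bF [v Fv] F0; rewrite ltNge; apply/negP => nF.
apply: F0; have allz u : F u -> u = 0.
  move=> Fu; apply/eqP; rewrite -normr_le0; apply: le_trans nF.
  exact: set_norm_ge.
by apply/seteqP; split=> [u /allz|_ ->] //=; rewrite -(allz _ Fv).
Qed.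

(* Testing the subdifferential inequality at [xbar - t *: u], where the
   infimal convolution is at most [t + a], and letting [t] go to [0]. *)
Lemma holder_subdiff_inf_gauge_polar (R : realType) (X : normedModType R)
    (s a : R) (F : set X) (f : X -> \bar R) (xbar : X)
    (xs : {linear X -> R^o}) (u : X) :
  0 < s -> inf_gauge_conv F f xbar = a%:E -> f xbar = a%:E ->
  holder_subdiff s (inf_gauge_conv F f) xbar xs -> F u -> - xs u <= 1.
Proof.
move=> s0 Ta fa /(holder_subdiffP _ s0 Ta)[_ [K K0 TK]] Fu.
have cvgt : xbar - t *: u @[t --> 0^'+] --> xbar.
  rewrite -[X in _ --> X]subr0 -[X in _ - X](scale0r u).
  by apply: cvgB; [exact: cvg_cst|apply: cvgZr_tmp; exact: cvg_at_right_filter].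
(* This is the remainder at [xbar - t *: u] divided by [t]; it vanishes in the limit because
   [s > 0]. *)
have cvgc : - K * `|u| `^ (1 + s) * t `^ s @[t --> 0^'+] --> (0 : R).
  rewrite -[X in _ --> X](mulr0 (- K * `|u| `^ (1 + s))).
  by apply: cvgMr; exact: powR_cvg0.
have TKt : \forall t \near 0^'+, ((a + xs (xbar - t *: u - xbar) -
    K * `|xbar - t *: u - xbar| `^ (1 + s))%:E <=
    inf_gauge_conv F f (xbar - t *: u)%R)%E by exact: (cvgt _ TK).
rewrite lerNl -subr_ge0 opprK.
apply: (ler_cvg_to cvgc (cvg_cst (xs u + 1))); near=> t.
have t0 : 0 < t by near: t; exact: nbhs_right_gt.
have : ((a + xs (xbar - t *: u - xbar) -
    K * `|xbar - t *: u - xbar| `^ (1 + s))%:E <= t%:E + a%:E)%E.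
  apply: (@le_trans _ _ (inf_gauge_conv F f (xbar - t *: u))); first by near: t.
  have := @inf_gauge_conv_le _ _ F f (xbar - t *: u) t u (ltW t0) Fu.
  by rewrite subrK fa.
rewrite -EFinD lee_fin (addrAC xbar) subrr add0r -scaleNr linearZ /=.
rewrite [GRing.scale _ (xs u)]mulNr.
rewrite normrZ normrN gtr0_norm// powRM ?(ltW t0)//.
rewrite (@powRD _ t) ?(gt_eqF t0) ?implybT// powRr1 ?(ltW t0)// => le_t.
rewrite -(ler_pM2l t0); lra.
Unshelve. all: by end_near. Qed.

Theorem corollary3p2 (R : realType) (X : normedModType R) (s : R) (F : set X)
    (f : X -> \bar R) (xbar : X) (l : R)
    (s_gt0 : 0 < s)
    (F_neq0 : F !=set0) (F_closed : closed F) (F_bounded : bounded_set F)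
    (F_convex : convex_set F) (F_neq_singleton0 : F <> [set 0])
    (f_gtNy : forall x, (-oo < f x)%E)
    (xbar_S0 : coincidence_set F f xbar)
    (l_ge0 : 0 <= l) (l_lt : l < (set_norm F)^-1)
    (f_lip : center_lipschitz f (edom f) xbar l) :
  holder_subdiff s (inf_gauge_conv F f) xbar =
  holder_subdiff s f xbar `&`
    [set xs : {linear X -> R^o} | top_dual X xs /\
      (ereal_sup [set (- xs u)%:E | u in F] <= 1)%E].
Proof.
have [a fa] : exists a, f xbar = a%:E.
  case: xbar_S0 => + Tf; rewrite /edom /= Tf.
  by case: (f xbar) => // a; exists a.
have Ta : inf_gauge_conv F f xbar = a%:E by case: xbar_S0 => _ ->.
have NF0 : 0 < set_norm F by exact: set_norm_gt0.
have fin_lip y r : f y = r%:E -> a - l * `|y - xbar| <= r.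
  move=> fy; have := @f_lip y; rewrite fy fa /edom /= fy => /(_ (ltry _)).
  by rewrite lee_fin ler_norml => /andP[+ _]; lra.
apply/seteqP; split=> xs.
- move=> xsT; have /(holder_subdiffP _ s_gt0 Ta)[cxs [K K0 TK]] := xsT.
  split; [|split=> //].
  + apply/(holder_subdiffP _ s_gt0 fa); split=> //; exists K => //.
    apply: filterS TK => x /le_trans; apply; exact: inf_gauge_conv_le_self.
  + apply/ereal_supP => _ [u Fu <-]; rewrite lee_fin.
    exact: (holder_subdiff_inf_gauge_polar s_gt0 Ta fa xsT Fu).
move=> [/(holder_subdiffP _ s_gt0 fa)[cxs [K K0 fK]] [_ xsF]].
have [k k0 xsk] := continuous_linear_lipschitz cxs.
have [e /= e0 fe] := (nbhs_normP _ _).1 fK.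
apply/(holder_subdiffP _ s_gt0 Ta); split=> //.
have d0 : 0 < 1 - l * set_norm F by rewrite subr_gt0 -ltr_pdivlMr// div1r.
(* [C] is chosen so that the bound [tle] on [t] below yields [|x + t *: u - xbar| <= C * rx]; the
   radius [e / C] then keeps [x + t *: u] within [e] of [xbar]. *)
pose C := 1 + set_norm F * ((k + l) / (1 - l * set_norm F)).
have C0 : 0 < C.
  by rewrite ltr_pwDl// mulr_ge0 ?(ltW NF0)// divr_ge0 ?(ltW d0)// addr_ge0.
exists (K * C `^ (1 + s)); first by rewrite mulr_ge0 ?powR_ge0.
apply/nbhs_normP; exists (e / C); first exact: divr_gt0.
move=> x /=; rewrite distrC ltr_pdivlMr// => xe; set rx := `|x - xbar| in xe *.
have rx0 : 0 <= rx by exact: normr_ge0.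
apply: inf_gauge_conv_ge => // t u t0 Fu.
case fy: (f _) (f_gtNy (x + t *: u)) => [r| |] // _; rewrite ?addey ?leey//.
rewrite -EFinD lee_fin.
have xsu : - xs u <= 1.
  by rewrite -lee_fin; apply: le_trans xsF; apply: ereal_sup_ubound; exists u.
have yx : x + t *: u - xbar = (x - xbar) + t *: u by rewrite addrAC.
have ny : `|x + t *: u - xbar| <= rx + t * set_norm F.
  rewrite yx (le_trans (ler_normD _ _))// lerD2l normrZ ger0_norm// ler_wpM2l//.
  exact: set_norm_ge.
have [far|close] := leP (a + xs (x - xbar)) (t + r).
  by apply: le_trans far; rewrite gerBl ?mulr_ge0 ?powR_ge0.
have xsx : xs (x - xbar) <= k * rx by rewrite (le_trans (ler_norm _)).
(* Combining [t + r < a + k * rx] with [r >= a - l * (rx + t * set_norm F)] gives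
   [t * (1 - l * set_norm F) <= (k + l) * rx]. *)
have tle : t <= (k + l) / (1 - l * set_norm F) * rx.
  rewrite mulrAC ler_pdivlMr//.
  have := fin_lip _ _ fy.
  have : l * `|x + t *: u - xbar| <= l * (rx + t * set_norm F).
    by rewrite ler_wpM2l.
  nra.
have nyC : `|x + t *: u - xbar| <= C * rx.
  apply: (le_trans ny); rewrite /C mulrDl mul1r lerD2l mulrC -mulrA.
  by rewrite ler_wpM2l// ltW.
have := fe (x + t *: u); rewrite fy lee_fin /= distrC => /(_ (le_lt_trans nyC _)).
rewrite mulrC => /(_ xe).
rewrite yx linearD linearZ /= -yx.
have : K * `|x + t *: u - xbar| `^ (1 + s) <= K * C `^ (1 + s) * rx `^ (1 + s).
  by rewrite -mulrA -powRM ?(ltW C0)// ler_wpM2l// ge0_ler_powR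
    ?nnegrE ?addr_ge0 ?(ltW s_gt0) ?mulr_ge0 ?(ltW C0).
have : - t <= t * xs u.
  by rewrite -[- t]mulr1 mulNr -mulrN ler_wpM2l// lerNl.
rewrite /GRing.scale /=; lra.
Qed.
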